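(* Let $k\ge0$, $n>2k$ and $0\le m\le\lfloor(n-2k)/2\rfloor$. For $z^n\in\mathcal Z^n$ let $\hat{\mathbf S}_{k,m}(z^n)=(\hat\sigma_{k+1},\dots,\hat\sigma_{n-k})$ be any minimizer of $\tilde L_{\mathbf S}(z^n)$ over $\mathbf S\in\mathcal S^n_{k,m}(z^n)$. Then for all $\epsilon>0$ and all $x^n\in\mathcal X^n$, $$\Pr\Big(L_{\hat{\mathbf S}_{k,m}(Z^n)}(x_{k+1}^{n-k},Z^n)-D_{k,m}(x^n,Z^n)>\epsilon\Big)\le 2(k+1)\exp\Bigg(-(n-2k)\Big[\frac{\epsilon^2}{2(k+1)L_{\max}^2}-2|\mathcal Z|^{2k}\Big\{h\Big(\frac{m}{n-2k}\Big)+\frac{(m+1)\ln N}{n-2k}\Big\}\Big]\Bigg),$$ where $h(x)=-x\ln x-(1-x)\ln(1-x)$ and $N=|\mathcal S|$.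
   Context: Let $\mathcal X,\mathcal Z,\hat{\mathcal X}$ be finite alphabets and $\Pi=\{\Pi(x,z)\}$ a $|\mathcal X|\times|\mathcal Z|$ stochastic matrix (discrete memoryless channel) of full row rank. For deterministic $x^n\in\mathcal X^n$, the channel output $Z^n$ has independent components with $\Pr(Z_t=z)=\Pi(x_t,z)$. Fix a loss $\Lambda:\mathcal X\times\hat{\mathcal X}\to[0,\infty)$, $\Lambda_{\max}=\max_{x,\hat x}\Lambda(x,\hat x)$. Let $\mathcal S$ be the set of all maps $s:\mathcal Z\to\hat{\mathcal X}$. Fix a real $|\mathcal Z|\times|\mathcal X|$ matrix $H$ with $\Pi H=I$; $h(z)\in\mathbb R^{\mathcal X}$ is the column vector equal to the $z$-th row of $H$. For $s\in\mathcal S$, $\rho_x(s)=\sum_z\Lambda(x,s(z))\Pi(x,z)$ and $\ell(z,s)=h(z)^T\rho(s)$. Let $\ell_{\max}=\max_{z,s}\ell(z,s)-\min_{z,s}\ell(z,s)$, $L_{\max}=\Lambda_{\max}+\ell_{\max}$. For $z^n$ and $k+1\le t\le n-k$ let $\mathbf c_t=(z_{t-k}^{t-1},z_{t+1}^{t+k})\in\mathcal Z^{2k}$, and for $\mathbf c\in\mathcal Z^{2k}$ let $\mathcal T(\mathbf c)=\{t:k+1\le t\le n-k,\ \mathbf c_t=\mathbf c\}$. Define $\mathcal S^n_{k,m}(z^n)$ as the set of tuples $\mathbf S=(\sigma_{k+1},\dots,\sigma_{n-k})\in\mathcal S^{n-2k}$ such that for every $\mathbf c\in\mathcal Z^{2k}$,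 writing $\mathcal T(\mathbf c)=\{\tau_1<\dots<\tau_r\}$, the number of $j<r$ with $\sigma_{\tau_j}\ne\sigma_{\tau_{j+1}}$ is at most $m$. For such $\mathbf S$ let $L_{\mathbf S}(x_{k+1}^{n-k},z^n)=\frac1{n-2k}\sum_{t=k+1}^{n-k}\Lambda(x_t,\sigma_t(z_t))$ and $\tilde L_{\mathbf S}(z^n)=\frac1{n-2k}\sum_{t=k+1}^{n-k}\ell(z_t,\sigma_t)$, and let $D_{k,m}(x^n,z^n)=\min_{\mathbf S\in\mathcal S^n_{k,m}(z^n)}L_{\mathbf S}(x_{k+1}^{n-k},z^n)$. *)

(* Defs.v *)
From HB Require Import structures.
From mathcomp Require Import all_boot all_order all_algebra.
From mathcomp Require Import reals sequences exp.
From mathcomp Require Import zify.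
Set Implicit Arguments. Unset Strict Implicit. Unset Printing Implicit Defensive.
Import Order.TTheory GRing.Theory Num.Theory.
Local Open Scope ring_scope.

(* Positions are 0-based: the paper's time t (1-based, k+1 <= t <= n-k)
   corresponds to the index j : 'I_(n-2k) with 0-based position k + j in 'I_n. *)
Lemma pos_lt (n k : nat) (j : 'I_(n - 2 * k)) : (k + j < n)%N.
Proof. have := ltn_ord j. lia. Qed.
Definition pos (n k : nat) (j : 'I_(n - 2 * k)) : 'I_n := Ordinal (pos_lt j).

(* i-th coordinate (i < 2k) of the context c_t = (z_{t-k}^{t-1}, z_{t+1}^{t+k}):
   0-based position j + i if i < k, and j + i + 1 if i >= k. *)
Lemma cpos_lt (n k : nat) (j : 'I_(n - 2 * k)) (i : 'I_(2 * k)) :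
  (j + i + (k <= i) < n)%N.
Proof. have := ltn_ord j; have := ltn_ord i; case: (k <= i)%N => /=; lia. Qed.
Definition cpos (n k : nat) (j : 'I_(n - 2 * k)) (i : 'I_(2 * k)) : 'I_n :=
  Ordinal (cpos_lt j i).

Section Defs.
Variables (R : realType) (X Z Xh : finType).
Variables (Pi : X -> Z -> R) (Lam : X -> Xh -> R) (H : Z -> X -> R).

Definition rho (x : X) (s : {ffun Z -> Xh}) : R := \sum_z Lam x (s z) * Pi x z.
Definition ell (z : Z) (s : {ffun Z -> Xh}) : R := \sum_x H z x * rho x s.

(* Lambda_max = max Lambda (Lambda >= 0, so the default 0 is harmless);
   ell_max = max ell - min ell = max over pairs of differences (which include 0). *)
Definition Lam_max : R := \big[Num.max/0]_(p : X * Xh) Lam p.1 p.2.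
Definition ell_max : R :=
  \big[Num.max/0]_(p : (Z * {ffun Z -> Xh}) * (Z * {ffun Z -> Xh}))
     (ell p.1.1 p.1.2 - ell p.2.1 p.2.2).
Definition L_max : R := Lam_max + ell_max.

Variables (n k m : nat).

Definition ctx (z : {ffun 'I_n -> Z}) (j : 'I_(n - 2 * k)) : {ffun 'I_(2 * k) -> Z} :=
  [ffun i => z (cpos j i)].

Definition nswitch (s : seq {ffun Z -> Xh}) : nat :=
  if s is a :: s' then count id (pairmap (fun u v => u != v) a s') else 0%N.

Definition admissible (z : {ffun 'I_n -> Z})
    (Sg : {ffun 'I_(n - 2 * k) -> {ffun Z -> Xh}}) : bool :=
  [forall c : {ffun 'I_(2 * k) -> Z},
     (nswitch [seq Sg j | j <- enum 'I_(n - 2 * k) & ctx z j == c] <= m)%N].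

Definition Lhat (x : 'I_n -> X) (z : {ffun 'I_n -> Z})
    (Sg : {ffun 'I_(n - 2 * k) -> {ffun Z -> Xh}}) : R :=
  ((n - 2 * k)%N%:R)^-1 * \sum_(j < n - 2 * k) Lam (x (pos j)) (Sg j (z (pos j))).

Definition Ltil (z : {ffun 'I_n -> Z})
    (Sg : {ffun 'I_(n - 2 * k) -> {ffun Z -> Xh}}) : R :=
  ((n - 2 * k)%N%:R)^-1 * \sum_(j < n - 2 * k) ell (z (pos j)) (Sg j).

(* D_{k,m}: min over admissible S of Lhat; the default Lam_max is an upper bound
   of every Lhat (an average of Lambda values), so the min is exact whenever the
   admissible set is nonempty (it always is: constant tuples are admissible). *)
Definition Dkm (x : 'I_n -> X) (z : {ffun 'I_n -> Z}) : R :=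
  \big[Num.min/Lam_max]_(Sg | admissible z Sg) Lhat x z Sg.

Definition Pr (x : 'I_n -> X) (E : pred {ffun 'I_n -> Z}) : R :=
  \sum_(z | E z) \prod_(t < n) Pi (x t) (z t).

End Defs.

(* binary entropy in nats (ln 0 = 0 in MathComp-Analysis, so 0 ln 0 = 0) *)
Definition hb (R : realType) (x : R) : R := - x * ln x - (1 - x) * ln (1 - x).

(* Main.v *)
(* For each fixed rule [s] the estimated loss [ell (Z_t) s] is an unbiased
   estimate of the true loss [Lam (x t) (s (Z_t))], and if the minimiser of the
   estimated loss is worse than the best tuple by [eps], some admissible tuple
   has an estimation error exceeding [eps / 2] in one of the two directions.
   Split the positions into the [k + 1] residue classes modulo [k + 1]. No
   context of a position involves another position of the same class, so given
   the symbols outside a class its contexts are determined and its symbols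
   remain independent. Within a class, Hoeffding's bound applies to each tuple
   and is summed over all tuples with weight [y] per change of rule; with
   [y = p / ((1 - p) * N)], [p = m / T], [T = n - 2 * k], the sum of the weights
   is governed by the entropy [hb p]. *)

Require Import Defs.
From mathcomp Require Import all_boot all_order all_algebra.
From mathcomp Require Import reals sequences exp.
From mathcomp Require Import unstable interval_inference convex.
From mathcomp Require Import topology normedtype derive realfun.
From mathcomp Require Import zify ring lra.
Set Implicit Arguments.
Unset Strict Implicit.
Unset Printing Implicit Defensive.
Import Order.TTheory GRing.Theory Num.Theory numFieldNormedType.Exports.
Local Open Scope ring_scope.

(** * Hoeffding's lemma for a finite distribution *)

Lemma is_derive_ge0_ndecr (R : realType) (f f' : R -> R) (a u v : R) :
  (forall w : R, is_derive w 1 f (f' w)) -> (forall w, a <= w -> 0 <= f' w) ->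
  a <= u -> u <= v -> f u <= f v.
Proof.
move=> df f'_ge0; apply: (@ger0_derive1_ndecry _ f a) => [w _|w|].
- exact: ex_derive.
- rewrite in_itv/= andbT derive1E (@derive_val _ _ _ _ _ _ _ (df w)).
  by move=> /ltW/f'_ge0.
- apply: continuous_subspaceT => w; apply: differentiable_continuous.
  exact/derivable1_diffP/ex_derive.
Qed.

Section BernoulliMgf.
Variables (R : realType) (p : R).
Hypothesis p01 : 0 <= p <= 1.

Definition bernoulli_mgf (v : R) : R := 1 - p + p * expR v.

Definition tilted_mean (v : R) : R := p * expR v * (bernoulli_mgf v)^-1.

Lemma bernoulli_mgf0 : bernoulli_mgf 0 = 1.
Proof. by rewrite /bernoulli_mgf expR0 mulr1 subrK. Qed.

Lemma bernoulli_mgf_gt0 v : 0 < bernoulli_mgf v.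
Proof.
have /andP[p_ge0 p_le1] := p01; rewrite /bernoulli_mgf.
have [->|pN0] := eqVneq p 0; first by rewrite subr0 mul0r addr0.
by rewrite ltr_wpDl ?subr_ge0// mulr_gt0 ?expR_gt0// lt_def pN0.
Qed.

Lemma bernoulli_mgf_neq0 v : bernoulli_mgf v != 0.
Proof. exact/lt0r_neq0/bernoulli_mgf_gt0. Qed.

Lemma is_derive_bernoulli_mgf (v : R) :
  is_derive v 1 bernoulli_mgf (p * expR v).
Proof. by apply: is_derive_eq; rewrite /GRing.scale /=; ring. Qed.

Lemma is_derive_ln_bernoulli_mgf (v : R) :
  is_derive v 1 (@ln R \o bernoulli_mgf) (tilted_mean v).
Proof.
have dM := is_derive_bernoulli_mgf v.
have := is_derive1_comp (is_derive1_ln (bernoulli_mgf_gt0 v)) dM.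
by rewrite mulrC.
Qed.

Lemma is_derive_tilted_mean (v : R) :
  is_derive v 1 tilted_mean (tilted_mean v * (1 - tilted_mean v)).
Proof.
have dMV := is_deriveV (bernoulli_mgf_neq0 v) (is_derive_bernoulli_mgf v).
apply: is_derive_eq; rewrite /GRing.scale /= /tilted_mean.
by field; exact: bernoulli_mgf_neq0.
Qed.

(* The second derivative of the left-hand side is a Bernoulli variance, hence
   at most [1 / 4]. *)
Lemma ln_bernoulli_mgf_le u : 0 <= u ->
  ln (bernoulli_mgf u) <= p * u + u ^+ 2 / 8.
Proof.
move=> u_ge0.
pose slack v := p * v + v ^+ 2 / 8 - ln (bernoulli_mgf v).
pose slack' v := p + v / 4 - tilted_mean v.
have dslack (v : R) : is_derive v 1 slack (slack' v).
  have := is_derive_ln_bernoulli_mgf v; rewrite /comp => dln.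
  by apply: is_derive_eq; rewrite /slack' /GRing.scale /=; field.
have dslack' (v : R) : is_derive v 1 slack' ((tilted_mean v - 1 / 2) ^+ 2).
  have := is_derive_tilted_mean v => dq.
  by apply: is_derive_eq; rewrite /GRing.scale /=; field.
have slack'_ge0 v : 0 <= v -> 0 <= slack' v.
  move=> v_ge0; have <- : slack' 0 = 0.
    by rewrite /slack' /tilted_mean bernoulli_mgf0 expR0; field.
  by apply: is_derive_ge0_ndecr dslack' _ (lexx 0) v_ge0 => w _; exact: sqr_ge0.
have : slack 0 <= slack u.
  by apply: is_derive_ge0_ndecr dslack slack'_ge0 (lexx 0) u_ge0.
by rewrite /slack bernoulli_mgf0 ln1 expr0n/= mulr0 mul0r addr0 subr0 subr_ge0.
Qed.

Lemma bernoulli_mgf_le u : 0 <= u ->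
  bernoulli_mgf u <= expR (p * u + u ^+ 2 / 8).
Proof.
move=> /ln_bernoulli_mgf_le.
by rewrite -ler_expR lnK// posrE bernoulli_mgf_gt0.
Qed.

End BernoulliMgf.

Lemma expR_le_chord (R : realType) (a b t : R) : a < b -> a <= t <= b ->
  expR t <= ((b - t) * expR a + (t - a) * expR b) / (b - a).
Proof.
move=> lt_ab /andP[le_at le_tb]; have ba_gt0 : 0 < b - a by rewrite subr_gt0.
have w_ge0 : 0 <= (b - t) / (b - a) by rewrite divr_ge0 ?subr_ge0// ltW.
have w_le1 : (b - t) / (b - a) <= 1 by rewrite ler_pdivrMr// mul1r lerB.
have := convex_expR (Itv01 w_ge0 w_le1) a b; rewrite !convRE/= /onem.
have baN0 := lt0r_neq0 ba_gt0.
rewrite (_ : _ * a + _ = t); last by field.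
by rewrite [X in _ <= X -> _](_ : _ =
  ((b - t) * expR a + (t - a) * expR b) / (b - a))//; field.
Qed.

Section FiniteDistribution.
Variables (R : realType) (Z : finType) (mu : Z -> R).
Hypotheses (mu_ge0 : forall z, 0 <= mu z) (mu_sum1 : \sum_z mu z = 1).

Lemma sum_affine_centered (f : Z -> R) (c d : R) : \sum_z mu z * f z = 0 ->
  \sum_z mu z * (c + d * f z) = c.
Proof.
move=> f_mean0; under eq_bigr do rewrite mulrDr mulrCA [mu _ * c]mulrC.
by rewrite big_split/= -!mulr_sumr mu_sum1 f_mean0 mulr0 addr0 mulr1.
Qed.

Lemma centered_itv_contains0 (f : Z -> R) (a b : R) :
  (forall z, a <= f z <= b) -> \sum_z mu z * f z = 0 -> a <= 0 <= b.
Proof.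
move=> f_itv f_mean0.
have le_mean g h : (forall z, g z <= h z) ->
    \sum_z mu z * g z <= \sum_z mu z * h z.
  by move=> gh; apply: ler_sum => z _; rewrite ler_wpM2l.
have mean_const c : \sum_z mu z * c = c by rewrite -mulr_suml mu_sum1 mul1r.
rewrite -f_mean0 -(mean_const a) -(mean_const b).
by rewrite !le_mean// => z; have /andP[] := f_itv z.
Qed.

(* The chord of [expR] over [a, b] is affine, so its mean only sees the mean of
   [f]: it is the value for the centered two-point law on [a] and [b]. *)
Lemma hoeffding_mgf_le (f : Z -> R) (a b : R) :
  (forall z, a <= f z <= b) -> \sum_z mu z * f z = 0 ->
  \sum_z mu z * expR (f z) <= expR ((b - a) ^+ 2 / 8).
Proof.
move=> f_itv f_mean0.
have /andP[a_le0 b_ge0] := centered_itv_contains0 f_itv f_mean0.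
have [lt_ab|le_ba] := ltP a b; last first.
  have f0 z : f z = 0 by have /andP[] := f_itv z; lra.
  under eq_bigr do rewrite f0 expR0 mulr1.
  by rewrite mu_sum1 -expR0 ler_expR divr_ge0// sqr_ge0.
have baN0 : b - a != 0 by rewrite lt0r_neq0// subr_gt0.
pose p := - a / (b - a).
have p01 : 0 <= p <= 1.
  by rewrite divr_ge0 ?ler_pdivrMr ?mul1r ?subr_gt0//=; lra.
pose chord0 := expR (- (p * (b - a))) * bernoulli_mgf p (b - a).
apply: (@le_trans _ _ chord0); last first.
  have ba_ge0 : 0 <= b - a by lra.
  rewrite -[leRHS](mulKf (lt0r_neq0 (expR_gt0 (p * (b - a))))) -expRN -expRD.
  by rewrite ler_wpM2l ?expR_ge0// bernoulli_mgf_le.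
rewrite -[leRHS](sum_affine_centered _ ((expR b - expR a) / (b - a)) f_mean0).
apply: ler_sum => z _; apply: ler_wpM2l => //.
rewrite [leRHS](_ : _ = ((b - f z) * expR a + (f z - a) * expR b) / (b - a)).
  exact: expR_le_chord.
have -> : expR b = expR a * expR (b - a) by rewrite -expRD subrKC.
rewrite /chord0 (_ : - (p * (b - a)) = a); last by rewrite /p; field.
by rewrite /bernoulli_mgf /p; field.
Qed.

Lemma hoeffding_mgf_range_le (f : Z -> R) (L : R) :
  (forall z z', f z - f z' <= L) -> \sum_z mu z * f z = 0 ->
  \sum_z mu z * expR (f z) <= expR (L ^+ 2 / 8).
Proof.
move=> f_range f_mean0.
have [z1 _|Z0] := pickP Z; last by rewrite big_pred0 ?expR_ge0.
pose z0 := [arg min_(z < z1) f z]%O.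
have f_min z : f z0 <= f z by rewrite /z0; case: arg_minP => // ? _; exact.
rewrite -[L](addrK (f z0)) hoeffding_mgf_le// => z.
by rewrite f_min/= -lerBlDr f_range.
Qed.

End FiniteDistribution.

(** * Product weights *)

Section Update.
Variables (I Z : finType).
Implicit Types (z : {ffun I -> Z}) (t : I) (a : Z).

Definition upd z t a : {ffun I -> Z} := [ffun i => if i == t then a else z i].

Lemma upd_same z t a : upd z t a t = a.
Proof. by rewrite ffunE eqxx. Qed.

Lemma upd_other z t a i : i != t -> upd z t a i = z i.
Proof. by move=> /negbTE it; rewrite ffunE it. Qed.

Lemma updK z t a : upd (upd z t a) t (z t) = z.
Proof. by apply/ffunP => i; rewrite !ffunE; case: eqP => // ->. Qed.

Lemma exchange_sum_upd (V : nmodType) t (G : {ffun I -> Z} -> Z -> V) :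
  \sum_z \sum_a G (upd z t a) (z t) = \sum_z \sum_a G z a.
Proof.
pose swap (p : {ffun I -> Z} * Z) := (upd p.1 t p.2, p.1 t).
have swapK : involutive swap by case=> z a; rewrite /swap/= updK upd_same.
by rewrite !pair_big/= [RHS](reindex_inj (inv_inj swapK)).
Qed.

Lemma sum_upd (R : pzSemiRingType) t (F : {ffun I -> Z} -> R) :
  \sum_z \sum_a F (upd z t a) = #|Z|%:R * \sum_z F z.
Proof.
rewrite (exchange_sum_upd t (fun z _ => F z)) mulr_sumr.
by apply: eq_bigr => z _; rewrite sumr_const mulr_natl.
Qed.

End Update.

Section Mean.
Variables (R : comNzRingType) (I Z : finType) (mu : I -> Z -> R).
Implicit Types F G : {ffun I -> Z} -> R.

Definition mean F : R := \sum_(z : {ffun I -> Z}) (\prod_i mu i (z i)) * F z.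

Lemma eq_mean F G : F =1 G -> mean F = mean G.
Proof. by move=> FG; apply: eq_bigr => z _; rewrite FG. Qed.

Lemma meanZ b F : mean (fun z => b * F z) = b * mean F.
Proof. by rewrite /mean mulr_sumr; apply: eq_bigr => z _; rewrite mulrCA. Qed.

Lemma mean_sum (T : finType) (F : T -> {ffun I -> Z} -> R) :
  mean (fun z => \sum_u F u z) = \sum_u mean (F u).
Proof.
by rewrite /mean exchange_big; apply: eq_bigr => z _; rewrite mulr_sumr.
Qed.

Hypothesis mu_sum1 : forall i, \sum_a mu i a = 1.

Lemma mean_cst b : mean (fun=> b) = b.
Proof. by rewrite /mean -mulr_suml -(bigA_distr_bigA mu) big1 ?mul1r. Qed.

Lemma mean_resample t F :
  mean (fun z => \sum_a mu t a * F (upd z t a)) = mean F.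
Proof.
pose weight z := \prod_i mu i (z i).
transitivity (\sum_(z : {ffun I -> Z}) \sum_a
    weight (upd z t a) * mu t (z t) * F (upd z t a)).
  apply: eq_bigr => z _; rewrite mulr_sumr.
  apply: eq_bigr => a _; rewrite mulrA.
  congr (_ * _); rewrite /weight (bigD1 t)//= [in RHS](bigD1 t)//= upd_same.
  under [in RHS]eq_bigr => i it do rewrite upd_other//.
  by ring.
rewrite (exchange_sum_upd t (fun z a => weight z * mu t a * F z)).
by apply: eq_bigr => z _; rewrite -mulr_suml -mulr_sumr mu_sum1 mulr1.
Qed.

End Mean.

Section MeanOrder.
Variables (R : numDomainType) (I Z : finType) (mu : I -> Z -> R).
Hypothesis mu_ge0 : forall i a, 0 <= mu i a.

Lemma ler_mean F G : (forall z, F z <= G z) -> mean mu F <= mean mu G.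
Proof. by move=> FG; apply: ler_sum => z _; rewrite ler_wpM2l// prodr_ge0. Qed.

Lemma weighted_union_bound (T : finType) (G : T -> {ffun I -> Z} -> R)
    (E : pred {ffun I -> Z}) (w : R) :
  (forall u z, 0 <= G u z) -> (forall z, E z -> exists u, w <= G u z) ->
  w * mean mu (fun z => (E z)%:R) <= \sum_u mean mu (G u).
Proof.
move=> G_ge0 wG; rewrite -mean_sum -meanZ; apply: ler_mean => z.
case Ez: (E z); last by rewrite mulr0 sumr_ge0.
have [u wGu] := wG z Ez; rewrite mulr1 (bigD1 u)//=.
by rewrite (le_trans wGu)// lerDl sumr_ge0.
Qed.

Hypothesis mu_sum1 : forall i, \sum_a mu i a = 1.

Lemma mean_prod_le (J : eqType) (tau : J -> I) (phi : J -> Z -> R)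
    (g : {ffun I -> Z} -> R) (B : R) (l : seq J) :
  (forall j a, 0 <= phi j a) ->
  (forall j, \sum_a mu (tau j) a * phi j a <= B) ->
  (forall z, 0 <= g z) -> (forall z j a, g (upd z (tau j) a) = g z) ->
  uniq (map tau l) ->
  mean mu (fun z => g z * \prod_(j <- l) phi j (z (tau j))) <=
  B ^+ size l * mean mu g.
Proof.
move=> phi_ge0 phi_le g_ge0 g_upd.
elim: l => [|j l IHl] /=.
  by rewrite mul1r => _; under eq_mean do rewrite big_nil mulr1.
move=> /andP[jl ul].
have B_ge0 : 0 <= B.
  by apply: le_trans (phi_le j); apply: sumr_ge0 => a _; rewrite mulr_ge0.
rewrite -(mean_resample mu_sum1 (tau j)) exprS -mulrA.
apply: le_trans (ler_wpM2l B_ge0 (IHl ul)); rewrite -meanZ.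
apply: ler_mean => z.
set G := \prod_(_ <- l) _.
have G_upd a : \prod_(i <- l) phi i (upd z (tau j) a (tau i)) = G.
  apply: eq_big_seq => i il; rewrite upd_other//.
  by apply: contraNneq jl => <-; exact: map_f.
under eq_bigr do rewrite big_cons g_upd upd_same G_upd mulrCA [mu _ _ * _]mulrA.
by rewrite -mulr_sumr -mulr_suml mulrCA ler_wpM2r// mulr_ge0// prodr_ge0.
Qed.

End MeanOrder.

(** * Counting changes of a rule along the classes of a coloring *)

Section Changes.
Variable A : eqType.
Implicit Types (a b : A) (s : seq A).

Definition nchange_from a s : nat := count id (pairmap (fun u v => u != v) a s).

Definition nchange s : nat := if s is a :: s' then nchange_from a s' else 0.

Lemma nchange_le_from a s : (nchange s <= nchange_from a s)%N.
Proof. by case: s => //= b s; rewrite leq_addl. Qed.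

Lemma nchange_from_head a s : nchange_from (head a s) s = nchange s.
Proof. by case: s => //= b s; rewrite /nchange_from/= eqxx. Qed.

Lemma nchange_from_triangle a b s :
  (nchange_from a s <= (a != b) + nchange_from b s)%N.
Proof.
case: s => //= c s; rewrite /nchange_from/= addnA leq_add2r.
by case: (eqVneq a b) => [->|]//=; case: (a != c).
Qed.

Lemma nchange_from_subseq a s1 s2 :
  subseq s1 s2 -> (nchange_from a s1 <= nchange_from a s2)%N.
Proof.
elim: s2 s1 a => [|b s2 IHs] [|c s1] a //=; case: eqP => [->|_] sub12.
  by rewrite /nchange_from/= leq_add2l; exact: IHs.
by apply: leq_trans (nchange_from_triangle a b _) _; rewrite leq_add2l IHs.
Qed.

Lemma nchange_subseq s1 s2 : subseq s1 s2 -> (nchange s1 <= nchange s2)%N.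
Proof.
case: s2 => [|b s2]; first by rewrite subseq0 => /eqP ->.
move=> /(nchange_from_subseq b); rewrite (nchange_from_head b (b :: s2)).
exact/leq_trans/nchange_le_from.
Qed.

End Changes.

Definition few_changes (J C A : finType) (m : nat) (color : J -> C)
    (f : {ffun J -> A}) : bool :=
  [forall c, (nchange [seq f j | j <- enum J & color j == c] <= m)%N].

Lemma val_enum_sig (T : finType) (P : {pred T}) :
  [seq val u | u <- enum {: {x | x \in P}}] = enum P.
Proof.
rewrite enumT unlock /= pmap_filter; last exact: insubK.
by apply: eq_filter => x; exact: isSome_insub.
Qed.

Lemma few_changes_restrict (J C A : finType) (P : {pred J}) (m : nat)
    (color : J -> C) (f : {ffun J -> A}) :
  few_changes m color f ->
  few_changes m (color \o val) [ffun j : {j | j \in P} => f (val j)].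
Proof.
move=> /forallP few; apply/forallP => c; apply: leq_trans (few c).
apply: nchange_subseq.
rewrite (eq_map (g := f \o val)); last by move=> j; rewrite ffunE.
rewrite map_comp; apply: map_subseq.
rewrite -(filter_map val (fun j => color j == c)) val_enum_sig.
rewrite subseq_filter filter_all /= (subseq_trans (filter_subseq _ _))//.
by rewrite [X in subseq _ X]enumT filter_subseq.
Qed.

Section ChangeWeight.
Variables (R : numDomainType) (J C A : finType) (y : R) (color : J -> C).
Hypothesis y_ge0 : 0 <= y.
Implicit Types (f : {ffun J -> A}) (init : {ffun C -> A}) (l : seq J).

Definition change_weight f : R :=
  \prod_c y ^+ nchange [seq f j | j <- enum J & color j == c].

(* [init c] is the rule in force on color [c] before the positions of [l]. *)
Definition change_weight_from init l f : R :=
  \prod_c y ^+ nchange_from (init c) [seq f j | j <- l & color j == c].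

Lemma change_weight_ge0 f : 0 <= change_weight f.
Proof. by apply: prodr_ge0 => c _; rewrite exprn_ge0. Qed.

Lemma few_changes_weight_ge m f : y <= 1 -> few_changes m color f ->
  y ^+ (m * #|C|) <= change_weight f.
Proof.
move=> y_le1 /forallP few; rewrite exprM -prodr_const.
by apply: ler_prod => c _; rewrite !exprn_ge0//= ler_wiXn2l.
Qed.

Lemma change_weight_le_sum_from f :
  (0 < #|A|)%N ->
  change_weight f <= \sum_init change_weight_from init (enum J) f.
Proof.
case/card_gt0P=> a0 _.
pose first_rule := [ffun c => head a0 [seq f j | j <- enum J & color j == c]].
rewrite (bigD1 first_rule)//= /change_weight_from.
under [X in _ <= X + _]eq_bigr do rewrite ffunE nchange_from_head.
rewrite lerDl sumr_ge0// => init _.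
by apply: prodr_ge0 => c _; rewrite exprn_ge0.
Qed.

Lemma change_weight_from_cons init j l f :
  change_weight_from init (j :: l) f =
  y ^+ (init (color j) != f j) *
  change_weight_from (upd init (color j) (f j)) l f.
Proof.
rewrite /change_weight_from (bigD1 (color j))//= [in RHS](bigD1 (color j))//=.
rewrite eqxx upd_same mulrA -exprD; congr (_ * _); apply: eq_bigr => c cj.
by rewrite upd_other// eq_sym (negbTE cj).
Qed.

Lemma change_weight_from_upd init l f j a : j \notin l ->
  change_weight_from init l (upd f j a) = change_weight_from init l f.
Proof.
move=> jl; apply: eq_bigr => c _; congr (_ ^+ nchange_from _ _).
apply/eq_in_map => i; rewrite mem_filter => /andP[_ il].
by rewrite upd_other//; apply: contraNneq jl => <-.
Qed.

Lemma sum_change1 b : \sum_a y ^+ (b != a :> A) = 1 + y *+ #|A|.-1.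
Proof.
rewrite (bigD1 b)//= eqxx expr0; congr (_ + _).
under eq_bigr => a ab do rewrite eq_sym ab expr1.
by rewrite sumr_const cardC1.
Qed.

Lemma sum_change_weight_from init l : uniq l ->
  #|A|%:R ^+ size l * \sum_f change_weight_from init l f =
  #|A|%:R ^+ #|J| * (1 + y *+ #|A|.-1) ^+ size l.
Proof.
elim: l init => [|j l IHl] init /=.
  rewrite !mul1r mulr1 -natrX -card_ffun -sumr_const => _.
  by apply: eq_bigr => f _; apply: big1.
move=> /andP[jl ul]; rewrite !exprSr mulrA.
rewrite -[X in _ = _ * X](sum_change1 (init (color j))).
rewrite -[LHS]mulrA -(sum_upd j) exchange_big/= !mulr_sumr.
apply: eq_bigr => a _; under eq_bigr do
  rewrite change_weight_from_cons upd_same change_weight_from_upd//.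
by rewrite -mulr_sumr mulrCA IHl// mulrC.
Qed.

Lemma sum_change_weight_le : (0 < #|A|)%N ->
  \sum_f change_weight f <= #|A|%:R ^+ #|C| * (1 + y *+ #|A|.-1) ^+ #|J|.
Proof.
move=> A_gt0.
apply: (@le_trans _ _ (\sum_f \sum_init change_weight_from init (enum J) f)).
  by apply: ler_sum => f _; exact: change_weight_le_sum_from.
rewrite exchange_big/= -natrX -card_ffun mulr_natl -sumr_const.
apply: ler_sum => init _.
have A_exp_gt0 : 0 < #|A|%:R ^+ #|J| :> R by rewrite exprn_gt0// ltr0n.
rewrite -(ler_pM2l A_exp_gt0).
by have := sum_change_weight_from init (enum_uniq J); rewrite -cardE => ->.
Qed.

End ChangeWeight.

(** * The entropy of the number of changes *)

Section Entropy.
Variable R : realType.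
Implicit Types (p : R) (N C T J m : nat).

Lemma hb_ge0 p : 0 <= p <= 1 -> 0 <= hb p.
Proof.
move=> /andP[p_ge0 p_le1]; rewrite /hb addr_ge0 ?mulNr ?oppr_ge0//.
  by rewrite mulr_ge0_le0// ln_le0.
by rewrite mulr_ge0_le0 ?subr_ge0// ln_le0// lerBlDr lerDl.
Qed.

Lemma hb_ratio_ge0 m T : (m <= T)%N -> 0 <= hb (m%:R / T%:R : R).
Proof.
move=> mT; apply: hb_ge0; rewrite divr_ge0//=.
have [->|T_gt0] := posnP T; first by rewrite invr0 mulr0.
by rewrite ler_pdivrMr ?ltr0n// mul1r ler_nat.
Qed.

Lemma ln_nat_ge0 N : 0 <= ln (N%:R : R).
Proof. by case: N => [|N]; [rewrite ln0 | rewrite ln_ge0// ler1n]. Qed.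

Lemma expR_nat_ln (b : R) m : (0 < m)%N ==> (0 < b) ->
  expR (m%:R * ln b) = b ^+ m.
Proof.
case: m => [_|m b_gt0]; first by rewrite mul0r expR0.
by rewrite expRM_natl lnK.
Qed.

Lemma expR_hb T m (p := m%:R / T%:R : R) : (0 < T)%N -> (m <= T)%N ->
  expR (- (T%:R * hb p)) = p ^+ m * (1 - p) ^+ (T - m).
Proof.
move=> T_gt0 mT; have TR : 0 < T%:R :> R by rewrite ltr0n.
rewrite -!expR_nat_ln; first last.
- by apply/implyP => m_gt0; rewrite divr_gt0 ?ltr0n.
- by apply/implyP; rewrite subn_gt0 subr_gt0 ltr_pdivrMr ?mul1r ?ltr_nat.
rewrite -expRD natrB//; congr expR; rewrite /hb /p; field; exact: lt0r_neq0.
Qed.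

Lemma expR_hb_odds T m (p := m%:R / T%:R : R) : (m < T)%N ->
  expR (T%:R * hb p) * (p / (1 - p)) ^+ m = (1 - p)^-1 ^+ T.
Proof.
move=> mT; have T_gt0 : (0 < T)%N by exact: leq_trans mT.
have p_lt1 : 0 < 1 - p by rewrite subr_gt0 ltr_pdivrMr ?ltr0n// mul1r ltr_nat.
have pm_neq0 : p ^+ m != 0.
  have [->|m_gt0] := posnP m; first by rewrite oner_eq0.
  by rewrite expf_neq0// lt0r_neq0// divr_gt0 ?ltr0n.
rewrite -[expR _]invrK -expRN expR_hb// 1?ltnW// -/p.
rewrite -[in RHS](subnK (ltnW mT)) exprD; clearbody p.
rewrite exprMn !exprVn; field.
by rewrite pm_neq0 !expf_neq0 ?lt0r_neq0.
Qed.

(* The price for which the weighted union bound is tight: the odds of change of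
   a coin with bias [m / T], split evenly among [N] rules. *)
Definition change_price (N T m : nat) : R :=
  m%:R / T%:R / (1 - m%:R / T%:R) / N%:R.

Lemma change_price_itv N T m : (0 < N)%N -> (0 < T)%N -> (2 * m <= T)%N ->
  0 <= change_price N T m <= 1.
Proof.
move=> N_gt0 T_gt0 mT; rewrite /change_price; set p := m%:R / T%:R.
have p_ge0 : 0 <= p by rewrite divr_ge0.
have p_le : p <= 1 / 2.
  rewrite ler_pdivrMr ?ltr0n// mulrAC ler_pdivlMr//.
  by rewrite mul1r mulrC -natrM ler_nat.
have odds_ge0 : 0 <= p / (1 - p) by rewrite divr_ge0//; lra.
have odds_le1 : p / (1 - p) <= 1 by rewrite ler_pdivrMr; lra.
by rewrite divr_ge0//= ler_pdivrMr ?ltr0n// mul1r (le_trans odds_le1)// ler1n.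
Qed.

Lemma change_price_exp_gt0 N T m C : (0 < N)%N -> (m < T)%N ->
  0 < change_price N T m ^+ (m * C).
Proof.
move=> N_gt0 mT; have [->|m_gt0] := posnP m; first by rewrite mul0n.
have T_gt0 : (0 < T)%N by exact: leq_trans mT.
rewrite exprn_gt0// !divr_gt0 ?ltr0n// subr_gt0 ltr_pdivrMr ?ltr0n//.
by rewrite mul1r ltr_nat.
Qed.

Lemma weighted_count_le_entropy N C T J m (y := change_price N T m) :
  (0 < N)%N -> (0 < C)%N -> (J <= T)%N -> (m < T)%N ->
  N%:R ^+ C * (1 + y *+ N.-1) ^+ J <=
  y ^+ (m * C) * expR (C%:R * (T%:R * hb (m%:R / T%:R) + m.+1%:R * ln N%:R)).
Proof.
move=> N_gt0 C_gt0 JT mT; have T_gt0 : (0 < T)%N by exact: leq_trans mT.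
rewrite {}/y /change_price; set p := m%:R / T%:R; set y := p / (1 - p) / _.
have NR : 0 < N%:R :> R by rewrite ltr0n.
have p_ge0 : 0 <= p by rewrite divr_ge0.
have p_lt1 : 0 < 1 - p by rewrite subr_gt0 ltr_pdivrMr ?ltr0n// mul1r ltr_nat.
have y_ge0 : 0 <= y by rewrite !divr_ge0// ltW.
have growth_le : 1 + y *+ N.-1 <= (1 - p)^-1.
  have -> : (1 - p)^-1 = 1 + y *+ N.
    by rewrite -mulr_natr /y; field; rewrite !lt0r_neq0.
  by rewrite lerD2l ler_wpMn2l// leq_pred.
have -> : y ^+ (m * C) * expR (C%:R * (T%:R * hb p + m.+1%:R * ln N%:R)) =
    (N%:R * (1 - p)^-1 ^+ T) ^+ C.
  rewrite exprM expRM_natl -exprMn expRD expR_nat_ln ?NR//; congr (_ ^+ _).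
  rewrite -(expR_hb_odds mT) -/p /y exprMn exprVn exprS; field.
  by rewrite expf_neq0// lt0r_neq0.
rewrite exprMn ler_wpM2l ?exprn_ge0// -exprM.
apply: (@le_trans _ _ ((1 - p)^-1 ^+ J)).
  have growth_ge0 : 0 <= 1 + y *+ N.-1 by rewrite addr_ge0 ?mulrn_wge0.
  by rewrite lerXn2r ?nnegrE ?growth_ge0// invr_ge0 ltW.
rewrite ler_weXn2l// ?invf_ge1 ?lerBlDr ?lerDl//.
by rewrite (leq_trans JT)// leq_pmulr.
Qed.

End Entropy.

(** * Deviations uniform over rules with few changes *)

Section Deviation.
Variables (R : realType) (I Z A C J : finType).
Variables (tau : J -> I) (color : {ffun I -> Z} -> J -> C).
Variable gap : J -> Z -> A -> R.
Variables (a : R) (m : nat).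

Definition deviation : pred {ffun I -> Z} :=
  [pred z | [exists f : {ffun J -> A},
     few_changes m (color z) f && (a < \sum_j gap j (z (tau j)) (f j))]].

Lemma deviation_card_gt0 z : 0 < a -> deviation z ->
  [/\ (0 < #|A|)%N, (0 < #|C|)%N & (0 < #|J|)%N].
Proof.
move=> a_gt0 /existsP[f /andP[_ dev]].
case: (pickP J) => [j _|J0]; last first.
  by move: dev; rewrite big_pred0// ltNge ltW.
by split; apply/card_gt0P; [exists (f j) | exists (color z j) | exists j].
Qed.

Variables (mu : I -> Z -> R) (L : R).
Hypothesis mu_ge0 : forall i b, 0 <= mu i b.
Hypothesis mu_sum1 : forall i, \sum_b mu i b = 1.
Hypothesis tau_inj : injective tau.
Hypothesis color_upd : forall z j b, color (upd z (tau j) b) =1 color z.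
Hypothesis gap_mean0 : forall j s, \sum_b mu (tau j) b * gap j b s = 0.
Hypothesis gap_range : forall j s b b', gap j b s - gap j b' s <= L.

(* Given the symbols off the block [tau], the colors are fixed and the block is
   still independent, so Hoeffding's lemma applies to each factor separately. *)
Lemma mean_change_weight_mgf_le (y lam : R) (f : {ffun J -> A}) :
  0 <= y -> 0 <= lam ->
  mean mu (fun z => change_weight y (color z) f *
                    \prod_j expR (lam * gap j (z (tau j)) (f j))) <=
  expR ((lam * L) ^+ 2 / 8) ^+ #|J| *
  mean mu (fun z => change_weight y (color z) f).
Proof.
move=> y_ge0 lam_ge0.
under eq_mean do rewrite -big_enum; rewrite cardE.
apply: (mean_prod_le mu_ge0 mu_sum1
  (phi := fun j b => expR (lam * gap j b (f j)))) => [j b|j|z|z j b|].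
- exact: expR_ge0.
- apply: hoeffding_mgf_range_le => // [b b'|].
    by rewrite -mulrBr ler_wpM2l.
  by under eq_bigr do rewrite mulrCA; rewrite -mulr_sumr gap_mean0 mulr0.
- exact: change_weight_ge0.
- apply: eq_bigr => c _; congr (_ ^+ nchange (map _ _)).
  by apply: eq_filter => i; rewrite color_upd.
- by rewrite map_inj_uniq// enum_uniq.
Qed.

Lemma deviation_chernoff (y lam : R) :
  0 <= y <= 1 -> 0 <= lam -> (0 < #|A|)%N ->
  y ^+ (m * #|C|) * expR (lam * a) * mean mu (fun z => (deviation z)%:R) <=
  expR ((lam * L) ^+ 2 / 8) ^+ #|J| *
  (#|A|%:R ^+ #|C| * (1 + y *+ #|A|.-1) ^+ #|J|).
Proof.
move=> /andP[y_ge0 y_le1] lam_ge0 A_gt0.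
pose G f z := change_weight y (color z) f *
  \prod_j expR (lam * gap j (z (tau j)) (f j)).
apply: (@le_trans _ _ (\sum_f mean mu (G f))).
  apply: weighted_union_bound => // [f z|z /existsP[f /andP[few dev]]].
    by rewrite mulr_ge0 ?change_weight_ge0// prodr_ge0.
  exists f; apply: ler_pM;
    rewrite ?exprn_ge0 ?expR_ge0 ?few_changes_weight_ge//.
  by rewrite -expR_sum ler_expR -mulr_sumr ler_wpM2l// ltW.
set B := expR _ ^+ _.
apply: (@le_trans _ _
  (\sum_f B * mean mu (fun z => change_weight y (color z) f))).
  by apply: ler_sum => f _; exact: mean_change_weight_mgf_le.
rewrite -mulr_sumr -mean_sum ler_wpM2l ?exprn_ge0 ?expR_ge0//.
rewrite -[leRHS](mean_cst mu_sum1); apply: ler_mean => // z.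
exact: sum_change_weight_le.
Qed.

Lemma deviation_le (T : nat) (r : R) : 0 < a -> 0 <= r ->
  r * (#|J|%:R * L ^+ 2) <= 2 * a ^+ 2 -> (#|J| <= T)%N -> (2 * m <= T)%N ->
  mean mu (fun z => (deviation z)%:R) <=
  expR (- r) *
  expR (#|C|%:R * (T%:R * hb (m%:R / T%:R) + m.+1%:R * ln #|A|%:R)).
Proof.
move=> a_gt0 r_ge0 r_le JT mT.
have [z0 dev_z0|dev0] := pickP deviation; last first.
  by rewrite /mean big1 ?mulr_ge0 ?expR_ge0// => z _; rewrite dev0 mulr0.
have [A_gt0 C_gt0 J_gt0] := deviation_card_gt0 a_gt0 dev_z0.
have m_lt_T : (m < T)%N by lia.
have T_gt0 : (0 < T)%N by exact: leq_trans m_lt_T.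
pose y : R := change_price R #|A| T m.
have y01 : 0 <= y <= 1 by exact: change_price_itv.
have y_exp_gt0 : 0 < y ^+ (m * #|C|) by exact: change_price_exp_gt0.
(* The best [lam] for the rate [r = 2 * a ^+ 2 / (#|J| * L ^+ 2)], in a form
   that also covers [L = 0]. *)
pose lam := 2 * r / a.
have lam_ge0 : 0 <= lam by rewrite divr_ge0 ?mulr_ge0// ltW.
rewrite -(ler_pM2l (mulr_gt0 y_exp_gt0 (expR_gt0 (lam * a)))).
apply: le_trans (deviation_chernoff y01 lam_ge0 A_gt0) _.
rewrite [y ^+ _ * _]mulrC mulrACA; apply: ler_pM.
- by rewrite exprn_ge0// expR_ge0.
- by rewrite mulr_ge0 ?exprn_ge0// addr_ge0 ?mulrn_wge0//; case/andP: y01.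
- have a_neq0 := lt0r_neq0 a_gt0.
  rewrite -expRM_natl -expRD ler_expR.
  have -> : lam * a - r = r by rewrite /lam; field.
  have -> : #|J|%:R * ((lam * L) ^+ 2 / 8) =
      r * (r * (#|J|%:R * L ^+ 2) / (2 * a ^+ 2)) by rewrite /lam; field.
  by rewrite ler_piMr// ler_pdivrMr ?mul1r// mulr_gt0 ?exprn_gt0.
- exact: weighted_count_le_entropy.
Qed.

End Deviation.

(** * Residue classes of positions *)

Lemma cpos_neq_pos (n k : nat) (j j' : 'I_(n - 2 * k)) (i : 'I_(2 * k)) :
  j = j' %[mod k.+1] -> cpos j i != pos j'.
Proof.
move=> jj'; apply/eqP => /(congr1 val)/= e; have := ltn_ord i.
have [le_jj'|/ltnW le_j'j] := leqP j j'.
  have /dvdn_leq : (k.+1 %| j' - j)%N by rewrite -eqn_mod_dvd// jj'.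
  by move: e; case: leqP => /=; lia.
have /dvdn_leq : (k.+1 %| j - j')%N by rewrite -eqn_mod_dvd// jj'.
by move: e; case: leqP => /=; lia.
Qed.

Lemma ctx_upd (Z : finType) (n k : nat) (z : {ffun 'I_n -> Z})
    (j j' : 'I_(n - 2 * k)) b :
  j = j' %[mod k.+1] -> ctx (upd z (pos j') b) j = ctx z j.
Proof.
move=> jj'; apply/ffunP => i.
by rewrite [LHS]ffunE [RHS]ffunE upd_other// cpos_neq_pos.
Qed.

Section ResidueClasses.
Variables (k T : nat).

Definition residue_class (i : 'I_k.+1) : {pred 'I_T} :=
  [pred j : 'I_T | (j %% k.+1 == i)%N].

Lemma big_residue_class (R : Type) (idx : R) (op : Monoid.com_law idx)
    (F : 'I_T -> R) :
  \big[op/idx]_j F j =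
  \big[op/idx]_i \big[op/idx]_(j : {j | j \in residue_class i}) F (val j).
Proof.
rewrite (partition_big (fun j : 'I_T => inord (j %% k.+1) : 'I_k.+1) xpredT)//=.
apply: eq_bigr => i _; rewrite -(big_sub (residue_class i)).
apply: eq_bigl => j.
by rewrite inE -val_eqE/= inordK ?ltn_pmod.
Qed.

Lemma sum_card_residue_class : (\sum_i #|residue_class i| = T)%N.
Proof.
transitivity (\sum_(j < T) 1)%N; last by rewrite sum1_card card_ord.
by rewrite big_residue_class; apply: eq_bigr => i _; rewrite sum1_card card_sig.
Qed.

Variables (R : realType) (eps : R).

(* Any thresholds adding up to [T * eps / 2] would do for the union bound; AM-GM
   makes these ones satisfy [threshold_rate_le]. *)
Definition threshold (i : 'I_k.+1) : R :=
  eps / 4 * (T%:R / k.+1%:R + #|residue_class i|%:R).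

Lemma sum_threshold : \sum_i threshold i = T%:R * (eps / 2).
Proof.
rewrite -mulr_sumr big_split/= sumr_const card_ord.
rewrite -natr_sum sum_card_residue_class.
by rewrite -[_ / _ *+ _]mulr_natr divfK ?pnatr_eq0//; lra.
Qed.

Lemma threshold_gt0 i : 0 < eps -> (0 < T)%N -> 0 < threshold i.
Proof.
move=> eps_gt0 T_gt0; rewrite /threshold mulr_gt0 ?divr_gt0//.
by rewrite ltr_wpDr// divr_gt0 ?ltr0n.
Qed.

(* When [L = 0] the rate is [0], as division by zero yields [0]. *)
Lemma threshold_rate_le i (L : R) :
  T%:R * (eps ^+ 2 / (2 * k.+1%:R * L ^+ 2)) *
  (#|residue_class i|%:R * L ^+ 2) <=
  2 * threshold i ^+ 2.
Proof.
have [->|LN0] := eqVneq L 0.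
  by rewrite !expr0n/= !mulr0 mulr_ge0// sqr_ge0.
rewrite /threshold exprMn; set c := #|_|%:R.
have : k.+1%:R != 0 :> R by rewrite pnatr_eq0.
move: (k.+1%:R : R) => K KN0.
have -> : T%:R * (eps ^+ 2 / (2 * K * L ^+ 2)) * (c * L ^+ 2) =
    eps ^+ 2 / 8 * (T%:R / K * c *+ 4) by field; rewrite KN0 LN0.
have -> : 2 * ((eps / 4) ^+ 2 * (T%:R / K + c) ^+ 2) =
    eps ^+ 2 / 8 * (T%:R / K + c) ^+ 2 by field.
by rewrite ler_wpM2l ?divr_ge0 ?sqr_ge0// leif_AGM2_scaled.
Qed.

End ResidueClasses.

(** * Estimated loss versus true loss *)

Section Loss.
Variables (R : realType) (X Z Xh : finType).
Variables (Pi : X -> Z -> R) (Lam : X -> Xh -> R) (H : Z -> X -> R).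
Local Notation rule := {ffun Z -> Xh}.

Definition loss_gap (x : X) (z : Z) (s : rule) : R :=
  Lam x (s z) - ell Pi Lam H z s.

Definition signed_loss_gap (b : bool) x z s : R := (-1) ^+ b * loss_gap x z s.

Lemma ell_unbiased x s :
  (forall x', \sum_z Pi x z * H z x' = (x == x')%:R) ->
  \sum_z Pi x z * ell Pi Lam H z s = rho Pi Lam x s.
Proof.
move=> PiH; under eq_bigr do rewrite mulr_sumr.
rewrite exchange_big/= (bigD1 x)//= [X in _ + X]big1 => [|x' x'x].
  under eq_bigr do rewrite mulrA.
  by rewrite -mulr_suml PiH eqxx mul1r addr0.
under eq_bigr do rewrite mulrA.
by rewrite -mulr_suml PiH eq_sym (negbTE x'x) mul0r.
Qed.

Lemma sum_signed_loss_gap b x s :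
  (forall x', \sum_z Pi x z * H z x' = (x == x')%:R) ->
  \sum_z Pi x z * signed_loss_gap b x z s = 0.
Proof.
move=> /(ell_unbiased s) unbiased; under eq_bigr do rewrite mulrCA mulrBr.
rewrite -mulr_sumr sumrB unbiased /rho.
by under eq_bigr do rewrite mulrC; rewrite subrr mulr0.
Qed.

Lemma loss_gap_range x z z' s : (forall x xh, 0 <= Lam x xh) ->
  loss_gap x z s - loss_gap x z' s <= L_max Pi Lam H.
Proof.
move=> Lam_ge0; rewrite /loss_gap /L_max.
have Lam_le : Lam x (s z) <= Lam_max Lam by apply: (le_bigmax _ _ (x, s z)).
have ell_le : ell Pi Lam H z' s - ell Pi Lam H z s <= ell_max Pi Lam H.
  exact: (le_bigmax _ (fun p : (Z * rule) * (Z * rule) =>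
    ell Pi Lam H p.1.1 p.1.2 - ell Pi Lam H p.2.1 p.2.2) ((z', s), (z, s))).
by have := Lam_ge0 x (s z'); lra.
Qed.

Lemma signed_loss_gap_range b x z z' s : (forall x xh, 0 <= Lam x xh) ->
  signed_loss_gap b x z s - signed_loss_gap b x z' s <= L_max Pi Lam H.
Proof.
move=> Lam_ge0; rewrite /signed_loss_gap -mulrBr; case: b.
  by rewrite expr1 mulN1r opprB loss_gap_range.
by rewrite expr0 mul1r loss_gap_range.
Qed.

Variables (n k m : nat) (x : 'I_n -> X) (z : {ffun 'I_n -> Z}).
Implicit Types Sg : {ffun 'I_(n - 2 * k) -> rule}.
Local Notation T := (n - 2 * k)%N.
Local Notation true_loss := (Lhat Lam (k := k) x z).
Local Notation est_loss := (Ltil Pi Lam H (k := k) z).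

Lemma Lhat_le_Lam_max Sg : true_loss Sg <= Lam_max Lam.
Proof.
rewrite /Lhat; have [T0|T_gt0] := posnP T.
  by rewrite [X in X%:R^-1]T0 invr0 mul0r bigmax_ge_id.
rewrite ler_pdivrMl ?ltr0n// -[in leRHS](card_ord T) mulr_natl -sumr_const.
by apply: ler_sum => j _; apply: (le_bigmax _ _ (x (pos j), Sg j (z (pos j)))).
Qed.

Lemma excess_loss_witness Sh (eps : R) : 0 < eps ->
  eps < true_loss Sh - Dkm Lam k m x z ->
  exists2 Sg, admissible (k := k) m z Sg &
    eps < true_loss Sh - true_loss Sg.
Proof.
move=> eps_gt0 lt_eps; case: (pickP (fun Sg => admissible (k := k) m z Sg &&
    (eps < true_loss Sh - true_loss Sg))) => [Sg /andP[]|none].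
  by exists Sg.
suff : true_loss Sh - eps <= Dkm Lam k m x z by lra.
apply: le_bigmin; first by have := Lhat_le_Lam_max Sh; lra.
by move=> Sg adm; have := none Sg; rewrite adm/= => /negbT; rewrite -leNgt; lra.
Qed.

Lemma sum_loss_gap Sg : (0 < T)%N ->
  \sum_j loss_gap (x (pos j)) (z (pos j)) (Sg j) =
  T%:R * (true_loss Sg - est_loss Sg).
Proof. by move=> T_gt0; rewrite -mulrBr mulVKf ?pnatr_eq0 -?lt0n// sumrB. Qed.

(* Either the true loss of the minimiser exceeds its estimate by [eps / 2]
   ([b = false]), or the estimated loss of a better tuple exceeds its true loss
   by [eps / 2] ([b = true]). *)
Lemma excess_loss_deviation Sh (eps : R) : (0 < T)%N -> 0 < eps ->
  admissible (k := k) m z Sh ->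
  (forall Sg, admissible (k := k) m z Sg ->
    est_loss Sh <= est_loss Sg) ->
  eps < true_loss Sh - Dkm Lam k m x z ->
  exists b, exists2 Sg, admissible (k := k) m z Sg &
    T%:R * (eps / 2) < \sum_j signed_loss_gap b (x (pos j)) (z (pos j)) (Sg j).
Proof.
move=> T_gt0 eps_gt0 Sh_adm Sh_min.
move=> /(excess_loss_witness eps_gt0)[Sg Sg_adm excess].
have TR : 0 < T%:R :> R by rewrite ltr0n.
have Ltil_le := Sh_min Sg Sg_adm.
pose gap_avg S := true_loss S - est_loss S.
have [Sh_dev|Sh_dev] := ltP (eps / 2) (gap_avg Sh).
  exists false, Sh => //.
  by rewrite -mulr_sumr expr0 mul1r sum_loss_gap// ltr_pM2l.
exists true, Sg => //.
rewrite -mulr_sumr expr1 mulN1r sum_loss_gap// -mulrN ltr_pM2l//.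
by move: Sh_dev; rewrite /gap_avg; lra.
Qed.

End Loss.

(** * The union bound over residue classes *)

Section Concentration.
Variables (R : realType) (X Z Xh : finType).
Variables (Pi : X -> Z -> R) (Lam : X -> Xh -> R) (H : Z -> X -> R).
Variables (k n m : nat).
Hypothesis Pi_ge0 : forall x z, 0 <= Pi x z.
Hypothesis Pi_sum1 : forall x, \sum_z Pi x z = 1.
Variables (eps : R) (x : 'I_n -> X).
Local Notation T := (n - 2 * k)%N.
Local Notation L := (L_max Pi Lam H).
Local Notation rule := {ffun Z -> Xh}.

Lemma Pr_mean (E : pred {ffun 'I_n -> Z}) :
  Pr Pi x E = mean (fun t => Pi (x t)) (fun z => (E z)%:R).
Proof.
rewrite /Pr big_mkcond; apply: eq_bigr => z _.
by case: ifP; rewrite ?mulr1 ?mulr0.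
Qed.

Lemma Pr_union_le (P : finType) (F : P -> pred {ffun 'I_n -> Z})
    (E : pred {ffun 'I_n -> Z}) (bound : R) :
  (forall z, E z -> exists p, F p z) -> (forall p, Pr Pi x (F p) <= bound) ->
  Pr Pi x E <= #|P|%:R * bound.
Proof.
move=> EF F_le; rewrite Pr_mean -[leLHS]mul1r mulr_natl -sumr_const.
pose G p z : R := (F p z)%:R.
apply: le_trans (weighted_union_bound (G := G) _ _ _) _ => //.
  by move=> z /EF[p Fpz]; exists p; rewrite /G Fpz.
by apply: ler_sum => p _; rewrite -Pr_mean.
Qed.

Definition class_deviation (p : 'I_k.+1 * bool) : pred {ffun 'I_n -> Z} :=
  deviation (J := {j : 'I_T | j \in residue_class p.1})
    (fun j => pos (val j)) (fun z j => ctx z (val j))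
    (fun j c (s : rule) => signed_loss_gap Pi Lam H p.2 (x (pos (val j))) c s)
    (threshold T eps p.1) m.

Lemma admissible_class_deviation (z : {ffun 'I_n -> Z}) Sg (b : bool) :
  admissible (k := k) m z Sg ->
  T%:R * (eps / 2) <
    \sum_j signed_loss_gap Pi Lam H b (x (pos j)) (z (pos j)) (Sg j) ->
  exists p, class_deviation p z.
Proof.
move=> adm; rewrite (big_residue_class k) -(sum_threshold k) => dev.
case: (pickP (fun i => class_deviation (i, b) z)) => [i dev_i|none].
  by exists (i, b).
move: dev; rewrite ltNge => /negP[]; apply: ler_sum => i _.
rewrite leNgt; apply/negP => dev_i.
move: (none i) => /negbT/existsPn/(_ [ffun j => Sg (val j)]) /negP[].
rewrite (few_changes_restrict (residue_class i) (color := ctx z) adm)/=.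
by under eq_bigr do rewrite ffunE.
Qed.

Lemma Pr_class_deviation_le p :
  (forall x x', \sum_z Pi x z * H z x' = (x == x')%:R) ->
  (forall x xh, 0 <= Lam x xh) -> 0 < eps -> (0 < T)%N -> (2 * m <= T)%N ->
  Pr Pi x (class_deviation p) <=
  expR (- (T%:R * (eps ^+ 2 / (2 * k.+1%:R * L ^+ 2)))) *
  expR (#|Z|%:R ^+ (2 * k) *
    (T%:R * hb (m%:R / T%:R) + m.+1%:R * ln #|{ffun Z -> Xh}|%:R)).
Proof.
move=> PiH Lam_ge0 eps_gt0 T_gt0 mT; case: p => i b; rewrite Pr_mean.
rewrite -natrX -[X in (_ ^ X)%N](card_ord (2 * k)) -card_ffun.
apply: (deviation_le (L := L)) => //.
- by move=> j j' /(congr1 val)/= e; exact/val_inj/val_inj/(addnI e).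
- move=> z j c j'; apply: ctx_upd.
  by have := valP j; have := valP j'; rewrite !inE => /eqP -> /eqP ->.
- by move=> j s; exact: sum_signed_loss_gap.
- by move=> j s c c'; exact: signed_loss_gap_range.
- exact: threshold_gt0.
- by rewrite mulr_ge0// divr_ge0 ?sqr_ge0// mulr_ge0 ?sqr_ge0 -?natrM.
- by rewrite card_sig threshold_rate_le.
- by rewrite card_sig (leq_trans (max_card _))// card_ord.
Qed.

End Concentration.

Lemma doubled_entropy_exponent_le (R : realType) (T gain h l C : R) :
  T != 0 -> 0 <= C * (T * h + l) ->
  - (T * gain) + C * (T * h + l) <= - (T * (gain - 2 * C * (h + l / T))).
Proof.
move=> TN0 Q_ge0; have -> : - (T * (gain - 2 * C * (h + l / T))) =
  - (T * gain) + (C * (T * h + l) + C * (T * h + l)) by field.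
by rewrite lerD2l lerDl.
Qed.

Theorem theorem3 (R : realType) (X Z Xh : finType)
  (Pi : X -> Z -> R) (Lam : X -> Xh -> R) (H : Z -> X -> R) (k n m : nat)
  (HPi0 : forall x z, 0 <= Pi x z) (HPi1 : forall x, \sum_z Pi x z = 1)
  (HH : forall x x', \sum_z Pi x z * H z x' = (x == x')%:R)
  (HLam : forall x xh, 0 <= Lam x xh)
  (Hn : (2 * k < n)%N) (Hm : (m <= (n - 2 * k)./2)%N)
  (Shat : {ffun 'I_n -> Z} -> {ffun 'I_(n - 2 * k) -> {ffun Z -> Xh}})
  (HS1 : forall z, admissible (k:=k) m z (Shat z))
  (HS2 : forall z Sg, admissible (k:=k) m z Sg ->
           Ltil Pi Lam H (k:=k) z (Shat z) <= Ltil Pi Lam H (k:=k) z Sg)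
  (eps : R) (Heps : 0 < eps) (x : 'I_n -> X) :
  Pr Pi x [pred z | Lhat Lam (k:=k) x z (Shat z) - Dkm Lam k m x z > eps]
  <= 2 * (k.+1)%:R *
     expR (- ((n - 2 * k)%N%:R *
        (eps ^+ 2 / (2 * (k.+1)%:R * (L_max Pi Lam H) ^+ 2)
         - 2 * (#|Z|%:R) ^+ (2 * k) *
           (hb (m%:R / (n - 2 * k)%N%:R)
            + (m.+1)%:R * ln (#|{ffun Z -> Xh}|%:R) / (n - 2 * k)%N%:R)))).
Proof.
have T_gt0 : (0 < n - 2 * k)%N by rewrite subn_gt0.
have TR : 0 < (n - 2 * k)%N%:R :> R by rewrite ltr0n.
have mT : (2 * m <= n - 2 * k)%N by lia.
set bound := expR _.
have -> : 2 * k.+1%:R = #|{: 'I_k.+1 * bool}|%:R :> R.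
  by rewrite card_prod card_ord card_bool natrM mulrC.
pose dev := class_deviation Pi Lam H (k := k) m eps x.
apply: (Pr_union_le HPi0 (F := dev)) => [z|p].
  move=> /(excess_loss_deviation T_gt0 Heps (HS1 z) (HS2 z))[b [Sg]].
  exact: admissible_class_deviation.
apply: le_trans (Pr_class_deviation_le HPi0 HPi1 _ p HH HLam Heps T_gt0 mT) _.
rewrite -expRD ler_expR doubled_entropy_exponent_le ?lt0r_neq0//.
rewrite mulr_ge0 ?exprn_ge0// addr_ge0 ?mulr_ge0 ?ln_nat_ge0//.
by rewrite hb_ratio_ge0//; lia.
Qed.
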